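(* Let $(S,+,\ast)$ be an Ehresmann semigroupoid with set of projections $U$, and let $C(S)$ be its associated local biordered Ehresmann category. The following conditions are equivalent: (a) $S$ is a category; (b) $U$ is a locally complete meet-semilattice; (c) $C(S)$ is a complete local biordered Ehresmann category.
   Context: **Semigroupoid.** A semigroupoid is a triple $(S,S^{(2)},\star)$ with $S$ a set, $S^{(2)}\subseteq S\times S$ and $\star\colon S^{(2)}\to S$ such that for all $s,t,r\in S$: if either ($(s,t),(t,r)\in S^{(2)}$), or ($(s,t),(s\star t,r)\in S^{(2)}$), or ($(t,r),(s,t\star r)\in S^{(2)}$), then all of $(s,t),(t,r),(s\star t,r),(s,t\star r)$ lie in $S^{(2)}$ and $(s\star t)\star r=s\star(t\star r)$. Write $st=s\star t$; ''$st$ is defined'' means $(s,t)\in S^{(2)}$. **Ehresmann semigroupoid (two-sided).** A triple $(S,+,\ast)$ with $S$ a semigroupoid and unary operations $s\mapsto s^+$, $s\mapsto s^\ast$ on $S$ such that for all $s,t\in S$: (i) $s^+s$ and $ss^\ast$ are defined, $s^+s=s$ and $ss^\ast=s$; (ii) if $s^+t^+$ is defined, then $t^+s^+$ is defined and $s^+t^+=t^+s^+$; if $s^\ast t^\ast$ is defined, then $t^\ast s^\ast$ is defined and $s^\ast t^\ast=t^\ast s^\ast$; (iii) if $s^+t^+$ is defined, then $s^+t^+=(s^+t)^+$; if $s^\ast t^\ast$ is defined, then $s^\ast t^\ast=(st^\ast)^\ast$; (iv) if $st$ is defined, then $(st)^+=(st^+)^+$ and $(st)^\ast=(s^\ast t)^\ast$;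 (v) $s^+=(s^+)^\ast$ and $s^\ast=(s^\ast)^+$. (The products on the right-hand sides in (iii), (iv) are automatically defined.) Its set of projections is $U=\{s^+:s\in S\}=\{s^\ast:s\in S\}$. **Category.** A (small) category consists of sets $\mathcal{C}_0\subseteq\mathcal{C}$, maps $D,R\colon\mathcal{C}\to\mathcal{C}_0$ and a partial operation $\circ$ on $\mathcal{C}$, with $x\circ y$ defined iff $D(x)=R(y)$, such that: $D(x\circ y)=D(y)$ and $R(x\circ y)=R(x)$; $\circ$ is associative on composable triples; for $e\in\mathcal{C}_0$, $D(e)=e=R(e)$, and $x\circ e=x$, $e\circ y=y$ whenever $D(x)=e=R(y)$. A semigroupoid $(S,S^{(2)},\star)$ ''is a category'' if there are a subset $S_0\subseteq S$ and maps $D,R\colon S\to S_0$ such that $S^{(2)}=\{(s,t):D(s)=R(t)\}$ and $(S,S_0,D,R,\star)$ is a category. **Local meet-semilattice.** A semigroupoid $X$ such that for every $e\in X$, $ee$ is defined and $ee=e$, and whenever $ef$ is defined, $fe$ is defined and $ef=fe$. Its partial order is: $e\leq f$ iff $ef$ is defined and $ef=e$. The operation is denoted $\wedge$ and is determined by $\leq$; a poset $(X,\le)$ is called a local meet-semilattice if $\le$ arises this way. For an Ehresmann semigroupoid $S$, the set $U$ with the composition of $S$ restricted to $(U\times U)\cap S^{(2)}$ is a local meet-semilattice. A local meet-semilattice is **locally complete** (a ''locally complete meet-semilattice'') if, as a semigroupoid, it is a category. **Ordered category.** $(\mathcal{C},\leq)$ with $\mathcal{C}$ a category and $\leq$ a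 partial order on $\mathcal{C}$ such that: $x\leq y$ implies $D(x)\leq D(y)$ and $R(x)\leq R(y)$; if $x\leq y$, $x'\leq y'$ and $x\circ x'$, $y\circ y'$ are defined, then $x\circ x'\leq y\circ y'$. It has restrictions if for each $x\in\mathcal{C}$ and $e\in\mathcal{C}_0$ with $e\leq D(x)$ there is a unique $x|e\in\mathcal{C}$ with $x|e\leq x$ and $D(x|e)=e$. It has corestrictions if for each $x\in\mathcal{C}$ and $e\in\mathcal{C}_0$ with $e\leq R(x)$ there is a unique $e|x\in\mathcal{C}$ with $e|x\leq x$ and $R(e|x)=e$. **Local biordered Ehresmann category.** A triple $(\mathcal{C},\leq_l,\leq_r)$ with $\mathcal{C}$ a category such that: (1) $(\mathcal{C},\leq_l)$ is an ordered category with corestrictions; (2) $(\mathcal{C},\leq_r)$ is an ordered category with restrictions; (3) $\mathcal{C}_0$ is a local meet-semilattice with partial order $\leq$ and operation $\wedge$; (4) $\leq_l$ and $\leq_r$ both restrict to $\leq$ on $\mathcal{C}_0$; (5) $\leq_l\circ\leq_r$ and $\leq_r\circ\leq_l$ coincide as relations on $\mathcal{C}$, where $x\,(P\circ Q)\,y$ iff there is $z$ with $x\,P\,z$ and $z\,Q\,y$; (6) if $x\leq_l y$, $e\in\mathcal{C}_0$ and $D(x)\wedge e$ is defined, then $x|(D(x)\wedge e)\leq_l y|(D(y)\wedge e)$; (7) if $x\leq_r y$, $e\in\mathcal{C}_0$ and $e\wedge R(x)$ is defined, then $(e\wedge R(x))|x\leq_r(e\wedge R(y))|y$. It is **complete**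 if $\mathcal{C}_0$ is a locally complete meet-semilattice. **Construction $C(S)$.** For an Ehresmann semigroupoid $(S,+,\ast)$ with projections $U$: $C(S)=S$ as a set, $C(S)_0=U$ (with $e\wedge f=ef$ whenever $ef$ is defined), $D(s)=s^\ast$, $R(s)=s^+$, $s\cdot t=st$ defined exactly when $s^\ast=t^+$; $s\leq_l t$ iff $s^+t$ is defined and $s^+t=s$; $s\leq_r t$ iff $ts^\ast$ is defined and $ts^\ast=s$. This is a local biordered Ehresmann category. *)

(* Defs.v *)
From Stdlib Require Import Relation_Definitions.
From mathcomp Require Import all_boot.
From mathcomp Require Import boolp classical_sets.

Set Implicit Arguments.
Unset Strict Implicit.
Unset Printing Implicit Defensive.

Local Open Scope classical_set_scope.

(* A partial operation is a map [op : T -> T -> option T]: the product of s and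
   t is defined iff [isSome (op s t)], and an equation between options whose
   one side is known to be defined asserts that the other side is defined too.
   [obind (op^~ r) (op s t)] is (st)r and [obind (op s) (op t r)] is s(tr).

   The notions which are also needed for a set of projections inside a larger
   structure are relative to a carrier [A : set T]; they only look at the
   restriction of [op] to A x A. *)
Section PartialOperations.
Context {T : Type}.
Implicit Types (A : set T) (op : T -> T -> option T).

Record semigroupoid A op : Prop := {
  sgpd_closed : forall s t u, A s -> A t -> op s t = Some u -> A u;
  sgpd_assoc : forall s t r, A s -> A t -> A r ->
    [\/ isSome (op s t) /\ isSome (op t r),
        isSome (obind (op^~ r) (op s t)) |
        isSome (obind (op s) (op t r))] ->
    [/\ isSome (op s t), isSome (op t r),
        isSome (obind (op^~ r) (op s t)),
        isSome (obind (op s) (op t r)) &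
        obind (op^~ r) (op s t) = obind (op s) (op t r)] }.

Record category A (A0 : set T) (D R : T -> T) op : Prop := {
  cat_ob : A0 `<=` A;
  cat_dom : forall x, A x -> A0 (D x);
  cat_cod : forall x, A x -> A0 (R x);
  cat_defined : forall x y, A x -> A y -> isSome (op x y) <-> D x = R y;
  cat_comp : forall x y z, A x -> A y -> op x y = Some z ->
    [/\ A z, D z = D y & R z = R x];
  cat_assoc : forall x y z, A x -> A y -> A z -> D x = R y -> D y = R z ->
    obind (op^~ z) (op x y) = obind (op x) (op y z);
  cat_id : forall e, A0 e -> D e = e /\ R e = e;
  cat_idr : forall x e, A x -> A0 e -> D x = e -> op x e = Some x;
  cat_idl : forall y e, A y -> A0 e -> R y = e -> op e y = Some y }.

Definition is_category A op : Prop :=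
  exists (A0 : set T) (D R : T -> T), category A A0 D R op.

Record local_meet_semilattice A op : Prop := {
  lms_semigroupoid : semigroupoid A op;
  lms_idem : forall e, A e -> op e e = Some e;
  lms_comm : forall e f, A e -> A f -> isSome (op e f) -> op f e = op e f }.

Definition meet_le op (e f : T) : Prop := op e f = Some e.

Definition locally_complete_meet_semilattice A op : Prop :=
  local_meet_semilattice A op /\ is_category A op.

End PartialOperations.

Record ehresmann_semigroupoid {S : Type} (mul : S -> S -> option S)
    (plus star : S -> S) : Prop := {
  ehr_semigroupoid : semigroupoid [set: S] mul;
  ehr_plusl : forall s, mul (plus s) s = Some s;
  ehr_starr : forall s, mul s (star s) = Some s;
  ehr_plusC : forall s t, isSome (mul (plus s) (plus t)) ->
    mul (plus s) (plus t) = mul (plus t) (plus s);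
  ehr_starC : forall s t, isSome (mul (star s) (star t)) ->
    mul (star s) (star t) = mul (star t) (star s);
  ehr_plusM : forall s t, isSome (mul (plus s) (plus t)) ->
    mul (plus s) (plus t) = omap plus (mul (plus s) t);
  ehr_starM : forall s t, isSome (mul (star s) (star t)) ->
    mul (star s) (star t) = omap star (mul s (star t));
  ehr_plus_cong : forall s t, isSome (mul s t) ->
    omap plus (mul s t) = omap plus (mul s (plus t));
  ehr_star_cong : forall s t, isSome (mul s t) ->
    omap star (mul s t) = omap star (mul (star s) t);
  ehr_plus_star : forall s, plus s = star (plus s);
  ehr_star_plus : forall s, star s = plus (star s) }.

Definition projections {S : Type} (plus : S -> S) : set S := range plus.

Lemma projections_star {S : Type} (mul : S -> S -> option S)
    (plus star : S -> S) :
  ehresmann_semigroupoid mul plus star -> projections plus = range star.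
Proof.
move=> hS; rewrite /projections; apply/seteqP; split=> _ [s _ <-].
- by exists (plus s) => //; rewrite -(ehr_plus_star hS).
- by exists (star s) => //; rewrite -(ehr_star_plus hS).
Qed.

Section OrderedCategories.
Context {C : Type}.
Variables (C0 : set C) (D R : C -> C) (comp : C -> C -> option C).
Implicit Types (le : C -> C -> Prop).

Record ordered_category le : Prop := {
  ocat_category : category [set: C] C0 D R comp;
  ocat_order : Relation_Definitions.order C le;
  ocat_dom : forall x y, le x y -> le (D x) (D y);
  ocat_cod : forall x y, le x y -> le (R x) (R y);
  ocat_comp : forall x y x' y' z w, le x y -> le x' y' ->
    comp x x' = Some z -> comp y y' = Some w -> le z w }.

(* [is_restriction le x e u] : u = x|e;  [is_corestriction le e x u] : u = e|x *)
Definition is_restriction le x e u : Prop := le u x /\ D u = e.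
Definition is_corestriction le e x u : Prop := le u x /\ R u = e.

Definition has_restrictions le : Prop := forall x e,
  C0 e -> le e (D x) -> exists! u, is_restriction le x e u.

Definition has_corestrictions le : Prop := forall x e,
  C0 e -> le e (R x) -> exists! u, is_corestriction le e x u.

End OrderedCategories.

(* The meet operation is determined by the order on [bc_ob]; it is recorded as
   data and only its values on [bc_ob] matter. *)
Record biordered_data (C : Type) := BiorderedData {
  bc_ob : set C;
  bc_dom : C -> C;
  bc_cod : C -> C;
  bc_comp : C -> C -> option C;
  bc_meet : C -> C -> option C;
  bc_lel : C -> C -> Prop;
  bc_ler : C -> C -> Prop }.

Section LocalBiorderedEhresmann.
Context {C : Type} (X : biordered_data C).
Let C0 := bc_ob X.
Let D := bc_dom X.
Let R := bc_cod X.
Let meet := bc_meet X.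
Let lel := bc_lel X.
Let ler := bc_ler X.

Record local_biordered_ehresmann : Prop := {
  lbe_lel : ordered_category C0 D R (bc_comp X) lel;
  lbe_corestr : has_corestrictions C0 R lel;
  lbe_ler : ordered_category C0 D R (bc_comp X) ler;
  lbe_restr : has_restrictions C0 D ler;
  lbe_meet : local_meet_semilattice C0 meet;
  lbe_lel_ob : forall e f, C0 e -> C0 f -> lel e f <-> meet_le meet e f;
  lbe_ler_ob : forall e f, C0 e -> C0 f -> ler e f <-> meet_le meet e f;
  lbe_commute : forall x y,
    (exists z, lel x z /\ ler z y) <-> (exists z, ler x z /\ lel z y);
  lbe_restr_lel : forall x y e m, lel x y -> C0 e -> meet (D x) e = Some m ->
    exists n u v, [/\ meet (D y) e = Some n, is_restriction D ler x m u,
                      is_restriction D ler y n v & lel u v];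
  lbe_corestr_ler : forall x y e m, ler x y -> C0 e -> meet e (R x) = Some m ->
    exists n u v, [/\ meet e (R y) = Some n, is_corestriction R lel m x u,
                      is_corestriction R lel n y v & ler u v] }.

Definition complete_local_biordered_ehresmann : Prop :=
  local_biordered_ehresmann /\ locally_complete_meet_semilattice C0 meet.

End LocalBiorderedEhresmann.

Definition ehresmann_category {S : Type} (mul : S -> S -> option S)
    (plus star : S -> S) : biordered_data S := {|
  bc_ob := projections plus;
  bc_dom := star;
  bc_cod := plus;
  bc_comp := fun s t => if `[< star s = plus t >] then mul s t else None;
  bc_meet := mul;
  bc_lel := fun s t => mul (plus s) t = Some s;
  bc_ler := fun s t => mul t (star s) = Some s |}.

(* Main.v *)
Require Import Defs.
From mathcomp Require Import all_boot.
From mathcomp Require Import boolp classical_sets.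

Set Implicit Arguments.
Unset Strict Implicit.
Unset Printing Implicit Defensive.

Local Open Scope classical_set_scope.

(** Write U for the set of projections. Everything rests on the fact that
    definedness of products is detected on projections: st is defined iff
    s^* t^+ is ([mul_defined]).

    If S is a category, each of its identities e satisfies e^+ e = e^+ (because
    e is an identity) and e^+ e = e, hence lies in U; so U contains all the
    identities and is a category for the inherited ones
    ([projections_category]).

    Conversely, let U be a category with domain d and codomain r. As ee is
    defined for every e in U, d = r on U: such a category is a disjoint union of
    meet-semilattices with top, and d e is the top of the component of e. Then
    S is a category whose identities are these tops, with domain s |-> d(s^* )
    and codomain s |-> r(s^+) ([category_of_projections]): by the fact above,
    st is defined iff s^* and t^+ are in the same component.

    Completeness of C(S) is by definition completeness of U once C(S) is known
    to be a local biordered Ehresmann category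
    ([ehresmann_category_local_biordered]). Here s <=_l t just means that
    s = et for some projection e, and s <=_r t that s = tf for some projection f,
    so the axioms that link the two orders are instances of (et)f = e(tf). Each
    axiom has a mirror image, obtained by applying the proof to the opposite
    semigroupoid ([ehresmann_dual]). *)

(** * Semigroupoids in relational form *)

(** The three definedness clauses of associativity, as statements about
    defined products; all later computations are chains of these. *)
Section Associativity.
Context {T : Type} {op : T -> T -> option T}.
Hypothesis hT : semigroupoid [set: T] op.

Lemma mul_assoc_def s t r a b : op s t = Some a -> op t r = Some b ->
  exists2 w, op a r = Some w & op s b = Some w.
Proof.
move=> st tr.
have /= := sgpd_assoc hT (s := s) (t := t) (r := r) I I I.
rewrite st tr /= => /(_ (Or31 _ _ (conj isT isT))) [_ _].
by case: (op a r) => [w|] // _ _ <-; exists w.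
Qed.

Lemma mul_assoc_left s t r a w : op s t = Some a -> op a r = Some w ->
  exists2 b, op t r = Some b & op s b = Some w.
Proof.
move=> st ar.
have /= := sgpd_assoc hT (s := s) (t := t) (r := r) I I I.
rewrite st /= ar => /(_ (Or32 _ _ isT)) [_].
by case: (op t r) => [b|] // _ _ _ /= wE; exists b.
Qed.

Lemma mul_assoc_right s t r b w : op t r = Some b -> op s b = Some w ->
  exists2 a, op s t = Some a & op a r = Some w.
Proof.
move=> tr sb.
have /= := sgpd_assoc hT (s := s) (t := t) (r := r) I I I.
rewrite tr /= sb => /(_ (Or33 _ _ isT)) [].
by case: (op s t) => [a|] // _ _ _ _ /= wE; exists a.
Qed.

End Associativity.

(** * Duality *)

Lemma semigroupoid_dual {T : Type} (op : T -> T -> option T) :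
  semigroupoid [set: T] op -> semigroupoid [set: T] (fun s t => op t s).
Proof.
move=> hT; split=> // s t r _ _ _ H.
have [] := @sgpd_assoc _ _ _ hT r t s I I I.
  by case: H => [[] | |] *; [constructor 1 | constructor 3 | constructor 2].
by move=> *; split.
Qed.

Lemma ehresmann_dual {S : Type} (mul : S -> S -> option S) (plus star : S -> S) :
  ehresmann_semigroupoid mul plus star ->
  ehresmann_semigroupoid (fun s t => mul t s) star plus.
Proof.
move=> hS; split.
- exact: semigroupoid_dual (ehr_semigroupoid hS).
- exact: ehr_starr hS.
- exact: ehr_plusl hS.
- by move=> s t; apply: @ehr_starC _ _ _ _ hS t s.
- by move=> s t; apply: @ehr_plusC _ _ _ _ hS t s.
- by move=> s t; apply: @ehr_starM _ _ _ _ hS t s.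
- by move=> s t; apply: @ehr_plusM _ _ _ _ hS t s.
- by move=> s t; apply: @ehr_star_cong _ _ _ _ hS t s.
- by move=> s t; apply: @ehr_plus_cong _ _ _ _ hS t s.
- exact: ehr_star_plus hS.
- exact: ehr_plus_star hS.
Qed.

Lemma category_dual {T : Type} (A A0 : set T) (D R : T -> T)
    (op : T -> T -> option T) :
  category A A0 D R op -> category A A0 R D (fun x y => op y x).
Proof.
case=> ob dom cod dfn comp assoc id idr idl; split=> //.
- by move=> x y Ax Ay; split=> [/(dfn _ _ Ay Ax)|/esym/(dfn _ _ Ay Ax)].
- by move=> x y z Ax Ay /(comp _ _ _ Ay Ax)[].
- by move=> x y z Ax Ay Az xy yz; rewrite assoc.
- by move=> e /id[].
Qed.

Lemma ordered_category_dual {T : Type} (C0 : set T) (D R : T -> T)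
    (op : T -> T -> option T) (le : T -> T -> Prop) :
  ordered_category C0 D R op le ->
  ordered_category C0 R D (fun x y => op y x) le.
Proof.
case=> cat ord dom cod comp; split=> //; first exact: category_dual.
by move=> x y x' y' z w xy xy' zE wE; apply: comp xy' xy zE wE.
Qed.

(** * Projections *)

Section Projections.
Context {S : Type} {mul : S -> S -> option S} {plus star : S -> S}.
Hypothesis hS : ehresmann_semigroupoid mul plus star.

Local Notation U := (projections plus).
Let sS := ehr_semigroupoid hS.

Lemma proj_plus s : U (plus s). Proof. by exists s. Qed.

Lemma proj_star s : U (star s).
Proof. by rewrite (projections_star hS); exists s. Qed.

Lemma star_proj e : U e -> star e = e.
Proof. by case=> s _ <-; rewrite -(ehr_plus_star hS). Qed.

Lemma plus_proj e : U e -> plus e = e.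
Proof. by move=> /star_proj {1 2}<-; rewrite -(ehr_star_plus hS). Qed.

Lemma proj_mulC e f a : U e -> U f -> mul e f = Some a -> mul f e = Some a.
Proof.
move=> /plus_proj eE /plus_proj fE ef.
by have := @ehr_plusC _ _ _ _ hS e f; rewrite eE fE ef => /(_ isT) <-.
Qed.

Lemma proj_idem e : U e -> mul e e = Some e.
Proof. by move=> /plus_proj eE; have := ehr_plusl hS e; rewrite eE. Qed.

Lemma proj_mul_plus e t b :
  U e -> mul e t = Some b -> mul e (plus t) = Some (plus b).
Proof.
move=> /plus_proj eE et.
have [a etp _] := mul_assoc_right sS (ehr_plusl hS t) et.
by have := @ehr_plusM _ _ _ _ hS e t; rewrite eE etp et => /(_ isT).
Qed.

Lemma proj_mul_closed e f a : U e -> U f -> mul e f = Some a -> U a.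
Proof.
move=> Ue Uf ef; have := proj_mul_plus Ue ef.
by rewrite plus_proj // ef => -[->]; apply: proj_plus.
Qed.

(** Cancel the local units in s = s s^* and t = t^+ t, or put them back. *)
Lemma mul_defined s t : isSome (mul s t) <-> isSome (mul (star s) (plus t)).
Proof.
split.
  case st: (mul s t) => [w|//] _.
  have [b sst _] := mul_assoc_left sS (ehr_starr hS s) st.
  by have [a -> _] := mul_assoc_right sS (ehr_plusl hS t) sst.
case st: (mul (star s) (plus t)) => [w|//] _.
have [a sa _] := mul_assoc_def sS (ehr_starr hS s) st.
by have [b _ ->] := mul_assoc_def sS sa (ehr_plusl hS t).
Qed.

Lemma proj_local_meet_semilattice : local_meet_semilattice U mul.
Proof.
split; last 2 first.
- exact: proj_idem.
- move=> e f Ue Uf; case ef: (mul e f) => [a|//] _.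
  exact: proj_mulC ef.
split; first exact: proj_mul_closed.
by move=> s t r _ _ _; apply: (sgpd_assoc sS).
Qed.

End Projections.

Lemma proj_mul_star {S : Type} {mul : S -> S -> option S} {plus star : S -> S} :
  ehresmann_semigroupoid mul plus star -> forall s e b,
  projections plus e -> mul s e = Some b -> mul (star s) e = Some (star b).
Proof.
move=> hS s e b Ue; apply: (proj_mul_plus (ehresmann_dual hS)).
by move: Ue; rewrite (projections_star hS).
Qed.

(** * Completeness *)

Section Completeness.
Context {S : Type} {mul : S -> S -> option S} {plus star : S -> S}.
Hypothesis hS : ehresmann_semigroupoid mul plus star.

Local Notation U := (projections plus).
Let sS := ehr_semigroupoid hS.

(** e^+ e is e by the Ehresmann axioms and e^+ because e is an identity. *)
Lemma identity_proj A0 D R e :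
  category [set: S] A0 D R mul -> A0 e -> U e.
Proof.
move=> cat eA0; exists e => //.
have ee := ehr_plusl hS e.
have De : D (plus e) = R e by apply/(cat_defined cat) => //; rewrite ee.
have := cat_idr cat (x := plus e) I eA0.
rewrite De (cat_id cat eA0).2 ee => /(_ erefl) [].
by move=> <-.
Qed.

Lemma projections_category : is_category [set: S] mul -> is_category U mul.
Proof.
case=> A0 [D [R cat]]; exists A0, D, R.
split.
- by move=> e; apply: identity_proj cat.
- by move=> x _; apply: (cat_dom cat I).
- by move=> x _; apply: (cat_cod cat I).
- by move=> x y _ _; apply: (cat_defined cat I I).
- move=> x y z Ux Uy xy; have [_ Dz Rz] := cat_comp cat I I xy.
  by split=> //; apply: (proj_mul_closed hS Ux Uy xy).
- by move=> x y z _ _ _; apply: (cat_assoc cat I I I).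
- exact: cat_id cat.
- by move=> x e _; apply: (cat_idr cat I).
- by move=> x e _; apply: (cat_idl cat I).
Qed.

Lemma category_of_projections : is_category U mul -> is_category [set: S] mul.
Proof.
case=> U0 [d [r cat]].
have Up := @proj_plus S plus.
have Us := @proj_star _ _ _ _ hS.
have drE e : U e -> d e = r e.
  by move=> Ue; apply/(cat_defined cat) => //; rewrite (proj_idem hS).
have dfn x y : isSome (mul x y) <-> d (star x) = r (plus y).
  by rewrite (mul_defined hS); apply: (cat_defined cat (Us x) (Up y)).
exists U0, (d \o star), (r \o plus); split=> //=.
- by move=> x _; apply: (cat_dom cat (Us x)).
- by move=> x _; apply: (cat_cod cat (Up x)).
- move=> x y z _ _ xy; split=> //.
    (* z y^* = z is defined, so z^* and y^* lie in the same component. *)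
    have [w zy yw] := mul_assoc_def sS xy (ehr_starr hS y).
    have /dfn -> : isSome (mul z (star y)) by rewrite zy.
    by rewrite (plus_proj hS) // drE.
  have [w xw xz] := mul_assoc_def sS (ehr_plusl hS x) xy.
  have /dfn <- : isSome (mul (plus x) z) by rewrite xz.
  by rewrite (star_proj hS) // drE.
- move=> x y z _ _ _ /dfn; case xy: (mul x y) => [a|//] _ /dfn.
  case yz: (mul y z) => [b|//] _ /=.
  by have [w -> ->] := mul_assoc_def sS xy yz.
- move=> e eU0; have Ue := cat_ob cat eU0.
  by rewrite (star_proj hS) // (plus_proj hS) //; apply: cat_id cat _ eU0.
- move=> x e _ eU0 /(cat_idr cat (Us x) eU0) xe.
  have [w] := mul_assoc_def sS (ehr_starr hS x) xe.
  by rewrite (ehr_starr hS) => -> <-.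
- move=> y e _ eU0 /(cat_idl cat (Up y) eU0) ey.
  have [w] := mul_assoc_def sS ey (ehr_plusl hS y).
  by rewrite (ehr_plusl hS) => <- ->.
Qed.

End Completeness.

(** * The local biordered Ehresmann category of an Ehresmann semigroupoid *)

Section Orders.
Context {S : Type} {mul : S -> S -> option S} {plus star : S -> S}.
Hypothesis hS : ehresmann_semigroupoid mul plus star.

Local Notation U := (projections plus).
Let sS := ehr_semigroupoid hS.
Local Notation X := (ehresmann_category mul plus star).
Local Notation lel := (bc_lel X).
Local Notation ler := (bc_ler X).

Lemma compE s t w : bc_comp X s t = Some w <-> star s = plus t /\ mul s t = Some w.
Proof. by rewrite /=; case: asboolP => [|n]; split=> // -[]. Qed.

Lemma comp_defined s t : star s = plus t -> exists w, mul s t = Some w.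
Proof.
move=> st; have /(mul_defined hS s t).2 : isSome (mul (star s) (plus t)).
  by rewrite st (proj_idem hS) //; apply: proj_plus.
by case: (mul s t) => [w|] // _; exists w.
Qed.

(** (st)^* = (s^* t)^* = (t^+ t)^* = t^* when s^* = t^+. *)
Lemma comp_star s t w : star s = plus t -> mul s t = Some w -> star w = star t.
Proof.
move=> st stw; have := @ehr_star_cong _ _ _ _ hS s t.
by rewrite stw st (ehr_plusl hS) => /(_ isT) [].
Qed.

Lemma comp_plus s t w : star s = plus t -> mul s t = Some w -> plus w = plus s.
Proof.
move=> st stw; have := @ehr_plus_cong _ _ _ _ hS s t.
by rewrite stw -st (ehr_starr hS) => /(_ isT) [].
Qed.

Lemma ehresmann_category_category :
  category [set: S] U star plus (bc_comp X).
Proof.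
split=> //=.
- by move=> x _; apply: (proj_star hS).
- by move=> x _; apply: proj_plus.
- move=> x y _ _; case: asboolP => // xy; split=> // _.
  by have [w ->] := comp_defined xy.
- move=> x y z _ _ /compE[xy xyz].
  by split=> //; [apply: comp_star xyz | apply: comp_plus xyz].
- move=> x y z _ _ _ xy yz; rewrite !asboolT //.
  have [a xya] := comp_defined xy; have [b yzb] := comp_defined yz.
  rewrite xya yzb /= (comp_star xy xya) (comp_plus yz yzb).
  by rewrite !asboolT //; have [w -> ->] := mul_assoc_def sS xya yzb.
- by move=> e Ue; rewrite (star_proj hS) // (plus_proj hS).
- move=> x e _ Ue xe; rewrite (plus_proj hS) // asboolT //.
  by rewrite -xe; apply: ehr_starr hS _.
- move=> x e _ Ue xe; rewrite (star_proj hS) // asboolT //.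
  by rewrite -xe; apply: ehr_plusl hS _.
Qed.

(** If s = et then s^+ = e t^+, so s^+ t = e(t^+ t) = s: any projection e
    witnessing s = et may be replaced by s^+. *)
Lemma lel_proj e s t : U e -> mul e t = Some s -> lel s t.
Proof.
move=> Ue et; have ets := proj_mul_plus hS Ue et.
have [w] := mul_assoc_def sS ets (ehr_plusl hS t).
by rewrite /= et => -> ->.
Qed.

Lemma lel_plus s t : lel s t -> mul (plus s) (plus t) = Some (plus s).
Proof. by apply: (proj_mul_plus hS); apply: proj_plus. Qed.

Lemma lel_star s t : lel s t -> mul (star s) (star t) = Some (star s).
Proof.
move=> st; apply: (proj_mul_star hS); first exact: (proj_star hS).
have [w sw] := mul_assoc_def sS st (ehr_starr hS t).
by rewrite st sw.
Qed.

Lemma lel_order : Relation_Definitions.order S lel.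
Proof.
split.
- by move=> s; apply: (ehr_plusl hS).
- move=> s t u st tu; have [w] := mul_assoc_def sS (lel_plus st) tu.
  by rewrite /= st => ->.
- move=> s t st ts.
  have /(proj_mulC hS) := lel_plus st.
  rewrite (lel_plus ts).
  move=> /(_ (proj_plus _) (proj_plus _)) [pE].
  by have := ehr_plusl hS t; rewrite pE; move: st => /= -> [].
Qed.

Lemma lel_ordered_category : ordered_category U star plus (bc_comp X) lel.
Proof.
split.
- exact: ehresmann_category_category.
- exact: lel_order.
- move=> x y /lel_star xy; apply: lel_proj xy.
  exact: (proj_star hS).
- by move=> x y /lel_plus xy; apply: lel_proj xy; apply: proj_plus.
- (* x x' = x (x'^+ y') = (x x^* ) y' = x y' = (x^+ y) y' = x^+ (y y'). *)
  move=> x y x' y' z w xy xy' /compE[xx' z_def] /compE[_ w_def].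
  have [a xa az] := mul_assoc_right sS xy' z_def.
  have := ehr_starr hS x; rewrite xx' xa => -[aE]; rewrite aE in az.
  have [b] := mul_assoc_left sS xy az.
  by rewrite w_def => -[<-]; apply: lel_proj; apply: proj_plus.
Qed.

Lemma lel_corestrictions : has_corestrictions U plus lel.
Proof.
move=> x e Ue; rewrite /= (plus_proj hS) // => ex.
have [w _ exw] := mul_assoc_def sS ex (ehr_plusl hS x).
exists w; split.
  split; first exact: lel_proj exw.
  by have := proj_mul_plus hS Ue exw; rewrite ex => -[].
by move=> u [/= + uE]; rewrite uE exw => -[].
Qed.

Lemma lel_ler_commute x y :
  (exists z, lel x z /\ ler z y) -> exists z, ler x z /\ lel z y.
Proof.
case=> z [xz zy]; have [w xy wx] := mul_assoc_right sS zy xz.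
exists w; split; last by apply: lel_proj xy; apply: proj_plus.
have sz := proj_mul_star hS (proj_star hS z) wx.
have [v] := mul_assoc_def sS (ehr_starr hS w) sz.
by rewrite /= wx => <- ->.
Qed.

(** x|(x^* e) is xe. *)
Lemma restriction_mul x e m : U e -> mul (star x) e = Some m ->
  exists2 u, is_restriction star ler x m u & mul x e = Some u.
Proof.
move=> Ue xe; have [w xew xm] := mul_assoc_def sS (ehr_starr hS x) xe.
have := proj_mul_star hS Ue xew; rewrite xe => -[mE].
by exists w => //; split; rewrite /= -?mE.
Qed.

Lemma lel_restriction x y e m : lel x y -> U e -> mul (star x) e = Some m ->
  exists n u v, [/\ mul (star y) e = Some n, is_restriction star ler x m u,
                    is_restriction star ler y n v & lel u v].
Proof.
move=> xy Ue xe.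
have [n yen _] := mul_assoc_left sS (lel_star xy) xe.
have [u uR xeu] := restriction_mul Ue xe.
have [v vR yev] := restriction_mul Ue yen.
exists n, u, v; split=> //.
have [w] := mul_assoc_left sS xy xeu.
by rewrite yev => -[<-]; apply: lel_proj; apply: proj_plus.
Qed.

End Orders.

Lemma ehresmann_category_local_biordered {S : Type} (mul : S -> S -> option S)
    (plus star : S -> S) : ehresmann_semigroupoid mul plus star ->
  local_biordered_ehresmann (ehresmann_category mul plus star).
Proof.
move=> hS; have hS' := ehresmann_dual hS.
have UE : projections star = projections plus by rewrite (projections_star hS).
(* C of the opposite semigroupoid is the opposite category, its order lel being
   the order ler of C(S). *)
have compE' s t : bc_comp (ehresmann_category (fun s t => mul t s) star plus) t s
    = bc_comp (ehresmann_category mul plus star) s t.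
  by rewrite /=; congr (if _ then _ else _); apply: asbool_equiv_eq; split.
split=> /=.
- exact: lel_ordered_category hS.
- exact: lel_corestrictions hS.
- have := ordered_category_dual (lel_ordered_category hS').
  rewrite UE; congr (ordered_category _ _ _ _ _).
  by apply/funext => s; apply/funext => t; rewrite compE'.
- by have := lel_corestrictions hS'; rewrite UE.
- exact: proj_local_meet_semilattice hS.
- by move=> e f Ue _; rewrite (plus_proj hS).
- move=> e f Ue Uf; rewrite (star_proj hS) // /meet_le.
  by split; apply: (proj_mulC hS).
- by move=> x y; split; [apply: (lel_ler_commute hS)
                        | apply: (lel_ler_commute hS')].
- exact: lel_restriction hS.
- move=> x y e m xy Ue em.
  by apply: (lel_restriction hS'); rewrite ?UE.
Qed.

Theorem proposition3p17 (S : Type) (mul : S -> S -> option S)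
    (plus star : S -> S) (hS : ehresmann_semigroupoid mul plus star) :
  (is_category [set: S] mul <->
   locally_complete_meet_semilattice (projections plus) mul) /\
  (locally_complete_meet_semilattice (projections plus) mul <->
   complete_local_biordered_ehresmann (ehresmann_category mul plus star)).
Proof.
split; split.
- move=> cat; split; first exact: proj_local_meet_semilattice hS.
  exact: projections_category hS cat.
- by case=> _; apply: category_of_projections hS.
- by move=> complete; split=> //; apply: ehresmann_category_local_biordered.
- by case.
Qed.
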